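(* For any metric space $(X,d)$, the following are equivalent: (1) $U(X)$ is a ring and every Bourbaki bounded set in $X$ is precompact; (2) there is a precompact set $L\subset X$ such that for each $\varepsilon>0$, $X\setminus B(L,\varepsilon)$ is uniformly isolated in $X$; (3) the completion of $X$ is a UC-space.
   Context: $U(X)$ is the set of all real-valued uniformly continuous functions on $(X,d)$; ''$U(X)$ is a ring'' means it is closed under pointwise product. A set $A\subset X$ is Bourbaki bounded (in $X$) if every $f\in U(X)$ is bounded on $A$. Precompact means totally bounded. $B(L,\varepsilon)=\{x\in X: d(x,y)<\varepsilon\text{ for some }y\in L\}$ is the $\varepsilon$-enlargement of $L$. A set $A\subset X$ is uniformly isolated in $X$ if there is $\eta>0$ such that $\{y\in X:d(x,y)<\eta\}=\{x\}$ for every $x\in A$. A metric space $Y$ is a UC-space (Atsuji space) if every real-valued continuous function on $Y$ is uniformly continuous. *)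

(* Defs.v *)
From HB Require Import structures.
From mathcomp Require Import all_boot all_order all_algebra.
From mathcomp Require Import all_classical all_reals all_analysis.
From mathcomp Require Import ring lra.

Set Implicit Arguments.
Unset Strict Implicit.
Unset Printing Implicit Defensive.

Import Order.TTheory GRing.Theory Num.Theory.
Import numFieldTopology.Exports numFieldNormedType.Exports.

Local Open Scope classical_set_scope.
Local Open Scope ring_scope.

Section Notions.
Context {R : realType} {X : metricType R}.
Implicit Types (A L : set X) (e : R).

Definition enlargement L e : set X :=
  [set x | exists2 y, L y & mdist x y < e].

(* The library's [precompact] means "with compact closure", which is strictly
   stronger in a space that is not complete. *)
Definition totally_bounded A : Prop :=
  forall e, 0 < e -> exists2 F : set X, finite_set F & A `<=` enlargement F e.

Definition Bourbaki_bounded A : Prop :=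
  forall f : X -> R, unif_continuous f -> [bounded f x | x in A].

Definition uniformly_isolated A : Prop :=
  exists2 eta : R, 0 < eta &
    forall x, A x -> [set y | mdist x y < eta] = [set x].

End Notions.

(* Sums, opposites and constants of uniformly continuous real functions are
   always uniformly continuous: only the product is at stake. *)
Definition U_is_ring {R : realType} (X : metricType R) : Prop :=
  forall f g : X -> R,
    unif_continuous f -> unif_continuous g -> unif_continuous (f \* g).

Definition UC_space {R : realType} (Y : metricType R) : Prop :=
  forall f : Y -> R, continuous f -> unif_continuous f.

(* [completeType] only covers pointed spaces, whence an explicit statement
   that also makes sense for the empty space. *)
Definition complete_space {R : realType} (Y : metricType R) : Prop :=
  forall F : set_system Y, ProperFilter F -> cauchy F -> exists l : Y, F --> l.

Definition is_completion {R : realType} (X Y : metricType R) (i : X -> Y) :=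
  [/\ complete_space Y, {mono i : x y / mdist x y} & dense (range i)].

(* A point p of the completion is represented by its distance function
   y |-> d(p, y) on X; these functions are exactly the uniform limits of the
   functions d(x, _) with x in X (Kuratowski embedding), and the distance is
   the uniform one. *)
Definition completion {R : realType} (X : metricType R) : Type :=
  {f : X -> R | forall e : R, 0 < e ->
                exists x, forall y, `|f y - mdist x y| <= e}.

Section Completion.
Context {R : realType} (X : metricType R).
Local Notation C := (completion X).
Implicit Types f g h : C.

HB.instance Definition _ := gen_eqMixin C.
HB.instance Definition _ := gen_choiceMixin C.

Definition completion_dist f g : R :=
  sup [set `|sval f y - sval g y| | y in [set: X]].

Let inh f : exists x : X, True.
Proof. by case: f => f /(_ 1 ltr01)[x _]; exists x. Qed.

Lemma mdist_diff (x x' y : X) : `|mdist x y - mdist x' y| <= mdist x x'.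
Proof.
rewrite ler_norml lerBlDr lerNl opprB lerBlDr metric_triangle andbT.
by rewrite (metric_sym x x') metric_triangle.
Qed.

Let diff_ub f g :
  has_ubound [set `|sval f y - sval g y| | y in [set: X]].
Proof.
case: f g => f Hf [g Hg] /=.
have [x fx] := Hf 1 ltr01; have [x' gx'] := Hg 1 ltr01.
exists (1 + mdist x x' + 1) => _ [y _ <-].
have -> : f y - g y = (f y - mdist x y) + (mdist x y - mdist x' y)
   + (mdist x' y - g y) by ring.
apply: le_trans (ler_normD _ _) _; apply: lerD; last by rewrite distrC.
by apply: le_trans (ler_normD _ _) _; apply: lerD => //; exact: mdist_diff.
Qed.

Lemma completion_dist_ge f g y : `|sval f y - sval g y| <= completion_dist f g.
Proof. by apply: ub_le_sup; [exact: diff_ub | exists y]. Qed.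

Lemma completion_dist_le f g (e : R) :
  (forall y, `|sval f y - sval g y| <= e) -> completion_dist f g <= e.
Proof.
move=> H; apply: ge_sup; last by move=> _ [y _ <-].
by have [x _] := inh f; exists `|sval f x - sval g x|; exists x.
Qed.

Let cdistxx f : completion_dist f f = 0.
Proof.
apply/eqP; rewrite eq_le completion_dist_le => [|y]; last by rewrite subrr normr0.
by have [x _] := inh f; apply: le_trans (completion_dist_ge f f x).
Qed.

Let cdist_pos f g : completion_dist f g = 0 -> f = g.
Proof.
move=> fg0; apply/eq_sig_hprop => [h|]; first exact: Prop_irrelevance.
apply/funext => y; apply/eqP; rewrite -subr_eq0 -normr_le0.
by apply: le_trans (completion_dist_ge f g y) _; rewrite fg0.
Qed.

Let cdist_sym f g : completion_dist f g = completion_dist g f.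
Proof.
by congr (sup _); apply/seteqP; split=> _ [y _ <-]; exists y; rewrite // distrC.
Qed.

Let cdist_triangle g f h :
  completion_dist f h <= completion_dist f g + completion_dist g h.
Proof.
apply: completion_dist_le => y.
rewrite -(subrK (sval g y) (sval f y)) -addrA.
apply: le_trans (ler_normD _ _) _.
by apply: lerD; exact: completion_dist_ge.
Qed.

HB.instance Definition _ := @isMetric.Build R C completion_dist
  cdistxx cdist_pos cdist_sym cdist_triangle.

Lemma to_completion_subproof (x : X) (e : R) : 0 < e ->
  exists x', forall y, `|mdist x y - mdist x' y| <= e.
Proof. by move=> e0; exists x => y; rewrite subrr normr0 ltW. Qed.

Definition to_completion (x : X) : C :=
  exist _ (mdist x) (@to_completion_subproof x).

Let complete_completion : complete_space C.
Proof.
move=> F FF /cauchy_ballP Fc.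
have Fex (e : R) : 0 < e -> exists f : C, F (ball f e).
  by move=> e0; have /cauchy_ballP/cauchyP := Fc; apply.
have lim_ex (y : X) : exists l : R, (fun f : C => sval f y) @ F --> l.
  suff /cauchy_cvg /cvg_ex : cauchy ((fun f : C => sval f y) @ F) by [].
  apply/cauchy_exP => e e0; have [f Ff] := Fex e e0.
  exists (sval f y); rewrite nbhs_simpl /=.
  apply: filterS Ff => g; rewrite ballEmdist /= => fg.
  by rewrite /ball /=; apply: le_lt_trans (completion_dist_ge f g y) fg.
pose h y := xget 0 [set l : R | (fun f : C => sval f y) @ F --> l].
have hP y : (fun f : C => sval f y) @ F --> h y.
  by have [l ?] := lim_ex y; exact: (@xgetPex _ 0 _ (lim_ex y)).
have near_h f (e : R) : 0 < e -> F (ball f e) ->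
    forall y, `|h y - sval f y| <= e.
  move=> e0 Ff y; apply/ler_addgt0Pr => d d0.
  have /cvgrPdist_lt/(_ _ d0) Fd := hP y.
  have [g [fg gd]] := filter_ex (filterI Ff Fd).
  rewrite -(subrK (sval g y) (h y)) -addrA addrC.
  apply: le_trans (ler_normD _ _) _; apply: lerD; last exact: ltW.
  move: fg; rewrite ballEmdist distrC => /ltW; apply: le_trans.
  exact: completion_dist_ge.
have Hh (e : R) : 0 < e -> exists x, forall y, `|h y - mdist x y| <= e.
  move=> e0; have e2 : 0 < e / 2 by rewrite divr_gt0.
  have [f Ff] := Fex _ e2.
  have [x fx] := (svalP f) _ e2; exists x => y.
  rewrite -(subrK (sval f y) (h y)) -addrA [leRHS]splitr.
  apply: le_trans (ler_normD _ _) _; apply: lerD => //.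
  exact: near_h.
exists (exist _ h Hh).
apply/metricType_numDomainType.fcvgrPdist_lt => e e0.
have e3 : 0 < e / 3 by rewrite divr_gt0.
have [f Ff] := Fex _ e3.
apply: filterS (Ff) => g fg.
apply: (@le_lt_trans _ _ (e / 3 + e / 3)).
  apply: le_trans (cdist_triangle f _ _) _; apply: lerD.
    by apply: completion_dist_le => y; exact: near_h.
  by move: fg; rewrite ballEmdist => /ltW.
lra.
Qed.

Lemma completionP : @is_completion R X C to_completion.
Proof.
split; first exact: complete_completion.
- move=> x y; apply/eqP; rewrite eq_le; apply/andP; split.
    by apply: completion_dist_le => z; exact: mdist_diff.
  have := completion_dist_ge (to_completion x) (to_completion y) y.
  by rewrite /= mdistxx subr0 ger0_norm // mdist_ge0.
- move=> O [f Of] oO; have : nbhs f O by exact: open_nbhs_nbhs.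
  move=> /metricType_numDomainType.nbhs_mdistP[e /= e0 eO].
  have e2 : 0 < e / 2 by rewrite divr_gt0.
  have [x fx] := (svalP f) _ e2.
  exists (to_completion x); split; last by exists x.
  apply: eO => /=; apply: (@le_lt_trans _ _ (e / 2)).
    exact: completion_dist_le.
  by rewrite ltr_pdivrMr // ltr_pMr // ltr1n.
Qed.

End Completion.

(* Main.v *)
(* All three conditions are equivalent to: for each e > 0 there is eta > 0 such
   that the points having another point at distance < eta are covered by
   finitely many e-balls. This property passes from a space to its completion
   and back by density.
   If it fails, some e-separated sequence x_n admits points y_n <> x_n with
   d(x_n, y_n) -> 0. Take the supremum of tents of height a_n centred at x_n and
   of radius d(x_n, y_n). For a_n = 1 it is continuous but not uniformly so. For
   a_n = 1/(n+1) it is uniformly continuous, but its product with f is not when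
   f is uniformly continuous with |f(x_n)| >= n+1; such an f exists, after
   extraction, when the range of x_n is not Bourbaki bounded.
   If it holds in a complete space and f violates uniform continuity for some
   e0, an ultrafilter containing all the sets
   {x | exists y, d(x, y) < d and |f x - f y| >= e0} is Cauchy, and f is not
   continuous at its limit. *)

Require Import Defs.
From mathcomp Require Import all_boot all_order all_algebra.
From mathcomp Require Import all_classical all_reals all_analysis.
From mathcomp Require Import ring lra.

Set Implicit Arguments.
Unset Strict Implicit.
Unset Printing Implicit Defensive.

Import Order.TTheory GRing.Theory Num.Theory.
Import numFieldTopology.Exports numFieldNormedType.Exports.

Local Open Scope classical_set_scope.
Local Open Scope ring_scope.

(** * Crowded points and metric forms of continuity *)

Definition finitely_covered {R : realType} {X : metricType R} (e : R)
    (A : set X) : Prop :=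
  exists2 F : set X, finite_set F & A `<=` enlargement F e.

(** For [eta > 0] the complement is the largest set that is uniformly isolated with constant
    [eta]. *)
Definition crowded {R : realType} (X : metricType R) (eta : R) : set X :=
  [set x | exists2 y, x != y & mdist x y < eta].
Arguments crowded {R} X eta.

Definition crowded_covered {R : realType} (X : metricType R) : Prop :=
  forall e : R, 0 < e -> exists2 eta : R, 0 < eta & finitely_covered e (crowded X eta).

Lemma unif_continuous_mdistP {R : realType} {X : metricType R} (f : X -> R) :
  unif_continuous f <-> forall e : R, 0 < e -> exists2 d, 0 < d &
    forall x y, mdist x y < d -> `|f x - f y| < e.
Proof.
rewrite unif_continuousP; split=> H e /H[d d0 fd]; exists d => //.
  by move=> x y xy; apply: (fd (x, y)); rewrite ballEmdist.
by case=> x y /=; rewrite ballEmdist => xy; apply: fd.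
Qed.

Lemma continuous_mdistP {R : realType} {X : metricType R} (f : X -> R) :
  continuous f <-> forall x (e : R), 0 < e -> exists2 d, 0 < d &
    forall y, mdist x y < d -> `|f x - f y| < e.
Proof.
split=> [cf x e e0|H x].
  have /cvgrPdist_lt/(_ e e0) := cf x.
  by move=> /metricType_numDomainType.nbhs_mdistP[d /= d0 xd]; exists d.
apply/cvgrPdist_lt => e e0; have [d d0 xd] := H x e e0.
by apply/metricType_numDomainType.nbhs_mdistP; exists d.
Qed.

Lemma invSn_small {R : realType} (e : R) : 0 < e ->
  exists N, forall n, (N <= n)%N -> n.+1%:R^-1 < e.
Proof.
move=> e0; have : 0 <= e^-1 by rewrite invr_ge0 ltW.
move=> /archi_boundP; set N := Num.bound _ => eN; exists N => n Nn.
rewrite invf_plt ?posrE//; apply: lt_le_trans eN _.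
by rewrite ler_nat ltnW.
Qed.

(** * Finite coverings and separated sequences *)

Section Coverings.
Context {R : realType} {X : metricType R}.
Implicit Types (A B : set X) (e eta : R).

Lemma crowded_le eta eta' : eta <= eta' -> crowded X eta `<=` crowded X eta'.
Proof. by move=> le x [y xy d]; exists y => //; apply: lt_le_trans le. Qed.

Lemma isolated_notin_crowded eta (x : X) : 0 < eta ->
  ~ crowded X eta x -> [set y | mdist x y < eta] = [set x].
Proof.
move=> eta0 xN; apply/seteqP; split=> [y /= xy|_ ->] /=; last by rewrite mdistxx.
by apply/esym/eqP/negPn/negP => xDy; apply: xN; exists y.
Qed.

Lemma finitely_covered_sub e A B :
  A `<=` B -> finitely_covered e B -> finitely_covered e A.
Proof. by move=> AB [F finF BF]; exists F => //; apply: subset_trans BF. Qed.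

(** Each useful centre is moved to a point of [A] in its ball, which doubles the radius;
    intersecting with [A] discards the default values of [c]. *)
Lemma finitely_covered_centered e A : finitely_covered e A ->
  exists F, [/\ finite_set F, F `<=` A & A `<=` enlargement F (e + e)].
Proof.
move=> [F finF AF]; pose c y := xget y [set x | A x /\ mdist x y < e].
exists (c @` F `&` A); split; last 2 first.
- by move=> x [].
- move=> x Ax; have [y Fy xy] := AF _ Ax.
  have [] : [set x | A x /\ mdist x y < e] (c y) by apply: (@xgetPex _ y); exists x.
  move=> Acy cy; exists (c y); first by split => //; exists y.
  apply: le_lt_trans (metric_triangle x y (c y)) _.
  by rewrite (metric_sym y); apply: ltrD.
- by apply: finite_setIl; apply: finite_image.
Qed.

(** Greedy choice: the finitely many points already chosen do not cover [P n], so some point of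
    [P n] is [e]-far from all of them. Letting [P] depend on [n] allows crowding radii that tend to
    0. *)
Lemma separated_seq e (P : nat -> set X) :
  (forall n, ~ finitely_covered e (P n)) ->
  exists2 x : nat -> X, forall n, P n (x n) &
    forall m n, m != n -> e <= mdist (x m) (x n).
Proof.
move=> NP.
have /choice[c cP] (s : seq X) : exists x, P (size s) x /\
    (forall y, y \in s -> e <= mdist y x).
  apply: contrapT => H; apply: (NP (size s)); exists [set` s] => // x Px.
  apply: contrapT => xN; apply: H; exists x; split=> // y ys.
  by rewrite leNgt; apply/negP => yx; apply: xN; exists y; rewrite // metric_sym.
pose t n := iter n (fun s => c s :: s) [::].
have szt n : size (t n) = n by elim: n => //= n ->.
exists (c \o t) => [n|]; first by have [] := cP (t n); rewrite szt.
have mem_t m n : (m < n)%N -> c (t m) \in t n.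
  elim: n => // n IH; rewrite ltnS leq_eqVlt => /predU1P[->|/IH mn] /=.
    by rewrite mem_head.
  by rewrite in_cons mn orbT.
move=> m n; rewrite neq_ltn => /orP[] /mem_t lt /=.
  by have [_] := cP (t n); apply.
by rewrite metric_sym; have [_] := cP (t m); apply.
Qed.

Lemma not_crowded_covered_seq : ~ crowded_covered X ->
  exists e (x y : nat -> X), [/\ 0 < e, forall n, x n != y n,
    forall n, mdist (x n) (y n) < e / 2, forall n, mdist (x n) (y n) < n.+1%:R^-1 &
    forall m n, m != n -> e <= mdist (x m) (x n)].
Proof.
move=> /existsNP[e /not_implyP[e0 H]].
have [|x xP xsep] := @separated_seq e (fun n => crowded X (Num.min (e / 2) n.+1%:R^-1)).
  move=> n cov; apply: H; exists (Num.min (e / 2) n.+1%:R^-1) => //.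
  by rewrite lt_min divr_gt0 //= invr_gt0.
have /choice[y yP] n : exists y, x n != y /\ mdist (x n) y < Num.min (e / 2) n.+1%:R^-1.
  by have [y] := xP n; exists y.
by exists e, x, y; split=> // n; have [xy] := yP n; rewrite lt_min => /andP[].
Qed.

End Coverings.

(** * Suprema of tents *)

Section Hump.
Context {R : realType} {X : metricType R}.
Variables (x : nat -> X) (r a : nat -> R).
Hypothesis r_gt0 : forall n, 0 < r n.
Hypothesis a01 : forall n, 0 <= a n <= 1.

Implicit Types (p q : X) (e : R).

Definition tent n p : R := a n * Num.max 0 (1 - mdist p (x n) / r n).

Definition hump p : R := sup [set tent n p | n in [set: nat]].

Lemma tent_ge0 n p : 0 <= tent n p.
Proof.
by rewrite mulr_ge0 ?le_max ?lexx //; have /andP[] := a01 n.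
Qed.

Lemma tent_le n p : tent n p <= a n.
Proof.
have /andP[a0 _] := a01 n; rewrite -[leRHS]mulr1 ler_wpM2l // ge_max ler01 /=.
by rewrite gerBl divr_ge0 ?mdist_ge0 // ltW.
Qed.

Lemma tent_center n : tent n (x n) = a n.
Proof. by rewrite /tent mdistxx mul0r subr0 max_r ?mulr1. Qed.

Lemma tent_far n p : r n <= mdist p (x n) -> tent n p = 0.
Proof.
move=> far; rewrite /tent max_l ?mulr0 // subr_le0 ler_pdivlMr ?mul1r //.
Qed.

Lemma tent_lipschitz n p q : `|tent n p - tent n q| <= (r n)^-1 * mdist p q.
Proof.
have /andP[a0 a1] := a01 n.
rewrite -mulrBr normrM ger0_norm //.
apply: (@le_trans _ _ (1 * ((r n)^-1 * `|mdist p (x n) - mdist q (x n)|))).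
  apply: ler_pM => //.
  rewrite -[X in X * `|_|]gtr0_norm ?invr_gt0 // -normrM.
  rewrite (mulrC _ (_ - _)) mulrBl.
  move: (_ / _) (mdist q _ / _) => u v.
  (* The truncation at 0 does not increase distances; the four cases are the signs of [1 - u] and
     [1 - v]. *)
  have [|] := leP 0 (1 - u); have [|] := leP 0 (1 - v).
  - by move=> _ _; rewrite -(distrC v u); have -> : 1 - u - (1 - v) = v - u by ring.
  - move=> v1 u1; rewrite subr0 (ger0_norm u1) distrC; apply: le_trans (ler_norm _); lra.
  - move=> v1 u1; rewrite sub0r normrN (ger0_norm v1); apply: le_trans (ler_norm _); lra.
  - by move=> _ _; rewrite subrr normr0.
rewrite mul1r ler_wpM2l ?invr_ge0 ?(ltW (r_gt0 n)) //.
exact: mdist_diff.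
Qed.


Lemma tent_has_sup p : has_sup [set tent n p | n in [set: nat]].
Proof.
split; first by exists (tent 0 p); exists 0.
exists 1 => _ [n _ <-]; apply: le_trans (tent_le n p) _.
by have /andP[] := a01 n.
Qed.

Lemma tent_le_hump n p : tent n p <= hump p.
Proof. by apply: ub_le_sup; [have [] := tent_has_sup p|exists n]. Qed.

Lemma hump_le p c : (forall n, tent n p <= c) -> hump p <= c.
Proof.
by move=> H; apply: ge_sup; [have [] := tent_has_sup p|move=> _ [n _ <-]].
Qed.

Lemma hump_far p : (forall n, r n <= mdist p (x n)) -> hump p = 0.
Proof.
move=> far; apply/eqP; rewrite eq_le; apply/andP; split.
  by apply: hump_le => n; rewrite tent_far.
exact: le_trans (tent_ge0 0 p) (tent_le_hump 0 p).
Qed.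

Lemma hump_diff p q e :
  (forall n, `|tent n p - tent n q| <= e) -> `|hump p - hump q| <= e.
Proof.
move=> H; rewrite ler_norml lerBlDr lerNl opprB lerBlDr; apply/andP; split.
  apply: hump_le => n; apply: le_trans (_ : tent n p + e <= _).
    by have := H n; rewrite distrC ler_norml lerBlDl => /andP[].
  by rewrite addrC lerD2l tent_le_hump.
apply: hump_le => n; apply: le_trans (_ : tent n q + e <= _).
  by have := H n; rewrite ler_norml lerBlDl => /andP[].
by rewrite addrC lerD2l tent_le_hump.
Qed.

(** The first [N] tents share the Lipschitz constant [K], so only the tail needs a separate
    estimate. The summand 1 keeps [K] positive when [N = 0]. *)
Lemma hump_near N e : 0 < e -> exists2 d, 0 < d & forall p q,
  (forall n, (N <= n)%N -> `|tent n p - tent n q| <= e) -> mdist p q < d ->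
  `|hump p - hump q| <= e.
Proof.
move=> e0; pose K := 1 + \sum_(n < N) (r n)^-1.
have rV0 n : 0 <= (r n)^-1 by rewrite invr_ge0 ltW.
have K0 : 0 < K by rewrite ltr_pwDl // sumr_ge0.
exists (e / K) => [|p q far pq]; first by rewrite divr_gt0.
apply: hump_diff => n; have [/far//|nN] := leqP N n.
apply: le_trans (tent_lipschitz n p q) _.
apply: (@le_trans _ _ (K * mdist p q)).
  rewrite ler_wpM2r ?mdist_ge0 // /K (bigD1 (Ordinal nN)) //=.
  by rewrite addrCA lerDl addr_ge0 // sumr_ge0.
by rewrite mulrC -ler_pdivlMr // ltW.
Qed.

(** A tail tent takes values in [[0, a n]], so it oscillates by less than [e / 2] whatever its
    radius. *)
Lemma hump_unif_continuous :
  (forall e : R, 0 < e -> exists N, forall n, (N <= n)%N -> a n < e) ->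
  unif_continuous hump.
Proof.
move=> a_small; apply/unif_continuous_mdistP => e e0.
have e2 : 0 < e / 2 by rewrite divr_gt0.
have [N Na] := a_small _ e2; have [d d0 H] := hump_near N e2.
exists d => // p q pq; apply: le_lt_trans (_ : e / 2 < e); last by lra.
apply: H => // n /Na ane; rewrite ler_norml.
have := (tent_ge0 n p, tent_le n p, (tent_ge0 n q, tent_le n q)).
by move=> [[p0 p1] [q0 q1]]; apply/andP; split; lra.
Qed.

(** Separated centres and shrinking radii make all but finitely many tents vanish near a given
    point. *)
Lemma hump_continuous e : 0 < e ->
  (forall m n, m != n -> e <= mdist (x m) (x n)) ->
  (forall d : R, 0 < d -> exists N, forall n, (N <= n)%N -> r n < d) ->
  continuous hump.
Proof.
move=> e0 xsep r_small; apply/continuous_mdistP => p c c0.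
(* At most one centre lies within [e / 2] of [p], since two would be closer than [e]; [M] is taken
   past it. *)
have [M Mfar] : exists M, forall n, (M <= n)%N -> e / 2 <= mdist p (x n).
  have [[m pm]|H] := pselect (exists m, mdist p (x m) < e / 2); last first.
    by exists 0 => n _; rewrite leNgt; apply/negP => pn; apply: H; exists n.
  exists m.+1 => n mn; rewrite leNgt; apply/negP => pn.
  have := xsep m n; rewrite neq_ltn mn => /(_ isT).
  by have := metric_triangle (x m) p (x n); rewrite (metric_sym (x m) p) => ? ?; lra.
(* If [q] is within [e / 4] of [p], it stays at least [e / 4] away from the far centres, hence
   outside their tents. *)
have [N Nr] := r_small (e / 4) ltac:(by rewrite divr_gt0).
have c2 : 0 < c / 2 by rewrite divr_gt0.
have [d d0 H] := hump_near (maxn M N) c2.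
exists (Num.min d (e / 4)) => [|q]; first by rewrite lt_min d0 divr_gt0.
rewrite lt_min => /andP[pd pe]; apply: le_lt_trans (_ : c / 2 < c); last by lra.
apply: H => // n; rewrite geq_max => /andP[/Mfar Mn /Nr Nn].
have tri := metric_triangle p q (x n).
by rewrite !tent_far ?subrr ?normr0 //; lra.
Qed.

End Hump.

(** * Tents along a separated sequence with close neighbours *)

Section CrowdedSequence.
Context {R : realType} {X : metricType R}.
Variables (e : R) (x y : nat -> X) (a : nat -> R).
Hypothesis e_gt0 : 0 < e.
Hypothesis xDy : forall n, x n != y n.
Hypothesis xy_half : forall n, mdist (x n) (y n) < e / 2.
Hypothesis xy_inv : forall n, mdist (x n) (y n) < n.+1%:R^-1.
Hypothesis x_sep : forall m n, m != n -> e <= mdist (x m) (x n).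
Hypothesis a01 : forall n, 0 <= a n <= 1.

Local Notation h := (hump x (fun n => mdist (x n) (y n)) a).

Lemma crowded_seq_mdist_gt0 n : 0 < mdist (x n) (y n).
Proof. by rewrite mdist_gt0. Qed.

Lemma hump_crowded_seql n : a n <= h (x n).
Proof.
by rewrite -(tent_center x (fun n => mdist (x n) (y n)) a n) tent_le_hump //;
  exact: crowded_seq_mdist_gt0.
Qed.

(** The point [y n] is on the boundary of its own tent. For [m != n] its distance to [x m] exceeds
    [e - e / 2], which is more than the radius of tent [m]. *)
Lemma hump_crowded_seqr n : h (y n) = 0.
Proof.
apply: hump_far => // [|m]; first exact: crowded_seq_mdist_gt0.
have [->|mn] := eqVneq m n; first by rewrite metric_sym.
have := (x_sep mn, xy_half n, xy_half m, metric_triangle (x m) (y n) (x n)).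
rewrite (metric_sym (x m) (y n)) (metric_sym (y n) (x n)).
by move=> [[[? ?] ?] ?]; lra.
Qed.

Lemma crowded_seq_radius_small (d : R) : 0 < d ->
  exists N, forall n, (N <= n)%N -> mdist (x n) (y n) < d.
Proof.
by move=> /invSn_small[N NP]; exists N => n /NP; apply: lt_trans.
Qed.

End CrowdedSequence.

(** * Necessity of [crowded_covered] *)

Lemma UC_crowded_covered {R : realType} {X : metricType R} :
  UC_space X -> crowded_covered X.
Proof.
move=> UC; apply: contrapT.
move=> /not_crowded_covered_seq[e [x [y [e0 xDy xyh xyi xsep]]]].
have a01 (n : nat) : 0 <= (1 : R) <= 1 by rewrite ler01 lexx.
have r0 := crowded_seq_mdist_gt0 xDy.
have := UC _ (hump_continuous r0 a01 e0 xsep (crowded_seq_radius_small xyi)).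
move=> /unif_continuous_mdistP/(_ 1 ltr01)[d d0 H].
have [N NP] := crowded_seq_radius_small xyi d0.
have := H _ _ (NP N (leqnn N)).
rewrite (hump_crowded_seqr xDy xyh xsep a01) subr0 ltNge => /negP; apply.
exact: le_trans (hump_crowded_seql xDy a01 N) (ler_norm _).
Qed.

(** A ball of radius [e / 2] contains at most one term, so sending each index to a centre near its
    term would inject the naturals into a finite set. *)
Lemma separated_not_totally_bounded {R : realType} {X : metricType R} (e : R)
    (x : nat -> X) : 0 < e -> (forall m n, m != n -> e <= mdist (x m) (x n)) ->
  ~ totally_bounded (range x).
Proof.
move=> e0 xsep /(_ (e / 2))[|F finF xF]; first by rewrite divr_gt0.
have /choice[g gP] n : exists y, F y /\ mdist (x n) y < e / 2.
  by have [y Fy xy] := xF (x n) ltac:(by exists n); exists y.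
apply: infinite_nat; rewrite (_ : [set: nat] = g @^-1` F); last first.
  by apply/seteqP; split=> // n _; have [] := gP n.
apply: finite_preimage finF => m n _ _ gmn; apply/eqP/negPn/negP => /xsep.
have [_ xm] := gP m; have [_ xn] := gP n.
have := metric_triangle (x m) (g m) (x n).
by move: xn; rewrite -gmn (metric_sym (x n)) => ???; lra.
Qed.

Lemma unbounded_subsequence {R : realType} (u : nat -> R) :
  (forall M, exists n, M < `|u n|) ->
  exists phi : nat -> nat, {homo phi : m n / (m < n)%N} /\
    forall n, n.+1%:R <= `|u (phi n)|.
Proof.
move=> unb.
have /choice[c cP] N : exists m, (N <= m)%N /\ N.+1%:R <= `|u m|.
  (* Adding the sum of all [|u k|] with [k < N] to the threshold forces the index found to be at
     least [N]. *)
  have [m um] := unb (N.+1%:R + \sum_(k < N) `|u k|); exists m; split.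
    rewrite leqNgt; apply/negP => mN; move: um; apply/negP; rewrite -leNgt.
    by rewrite (bigD1 (Ordinal mN)) //= addrCA lerDl addr_ge0 // sumr_ge0.
  by apply: le_trans (ltW um); rewrite lerDl sumr_ge0.
pose phi := fix phi n := if n is n'.+1 then c (phi n').+1 else c 0%N.
have phiS : {homo phi : m n / (m < n)%N}.
  by apply: homo_ltn => [? ? ?|n]; [exact: ltn_trans|have [] := cP (phi n).+1].
have phi_ge n : (n <= phi n)%N.
  by elim: n => // n IH; apply: leq_ltn_trans IH (phiS _ _ (ltnSn n)).
exists phi; split=> // -[|n]; first by have [] := cP 0%N.
(* The bound obtained is [(phi n).+2], which dominates [n.+2] by [phi_ge]. *)
have [_] := cP (phi n).+1; apply: le_trans; rewrite ler_nat /= !ltnS.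
exact: phi_ge.
Qed.

Lemma ring_crowded_covered {R : realType} {X : metricType R} :
  U_is_ring X -> (forall A : set X, Bourbaki_bounded A -> totally_bounded A) ->
  crowded_covered X.
Proof.
move=> ringX BT; apply: contrapT.
move=> /not_crowded_covered_seq[e [x [y [e0 xDy xyh xyi xsep]]]].
have /existsNP[f /not_implyP[uf fN]] :
    ~ Bourbaki_bounded (range x).
  by move=> /BT; apply: separated_not_totally_bounded e0 xsep.
have [|phi [phi_lt fphi]] := @unbounded_subsequence _ (f \o x).
  move=> M; apply: contrapT => H; apply: fN; exists M; split; first exact: num_real.
  move=> M' MM' _ [n _ <-] /=; apply: le_trans (ltW MM').
  by rewrite leNgt; apply/negP => fn; apply: H; exists n.
have phi_ge n : (n <= phi n)%N.
  by elim: n => // n IH; apply: leq_ltn_trans IH (phi_lt _ _ (ltnSn n)).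
pose a n : R := n.+1%:R^-1.
have a01 n : 0 <= a n <= 1 by rewrite invr_ge0 ler0n /= invf_le1 // ler1n.
have xDy' n : (x \o phi) n != (y \o phi) n by exact: xDy.
have xyh' n : mdist ((x \o phi) n) ((y \o phi) n) < e / 2 by exact: xyh.
have xyi' n : mdist ((x \o phi) n) ((y \o phi) n) < n.+1%:R^-1.
  apply: lt_le_trans (xyi (phi n)) _.
  by rewrite lef_pV2 ?posrE // ler_nat ltnS.
have xsep' m n : m != n -> e <= mdist ((x \o phi) m) ((x \o phi) n).
  rewrite neq_ltn => /orP[]/phi_lt mn; apply: xsep; rewrite neq_ltn mn //.
  by rewrite orbT.
have := ringX _ _ uf (hump_unif_continuous (x \o phi) (crowded_seq_mdist_gt0 xDy') a01
  (@invSn_small R)).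
move=> /unif_continuous_mdistP/(_ 1 ltr01)[d d0 H].
have [N NP] := crowded_seq_radius_small xyi' d0.
have := H _ _ (NP N (leqnn N)).
rewrite /= (hump_crowded_seqr xDy' xyh' xsep' a01) mulr0 subr0 ltNge.
move=> /negP; apply; rewrite normrM.
have aN : 0 < a N by rewrite invr_gt0.
(* The product vanishes at [y (phi N)], while at [x (phi N)] the growth of [f] compensates the
   height [a N] exactly. *)
apply: (@le_trans _ _ (N.+1%:R * a N)); first by rewrite divff.
apply: ler_pM => //; first exact: ltW.
exact: le_trans (hump_crowded_seql xDy' a01 N) (ler_norm _).
Qed.

(** * Sufficiency of [crowded_covered] *)

Section FromCoverings.
Context {R : realType} {X : metricType R}.
Hypothesis ccX : crowded_covered X.

(** Distinct points closer than [eta] are both crowded, so the usual product estimate is needed only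
    on the crowded set. There [f] and [g] are bounded, being within 1 of their values at finitely
    many centres. *)
Lemma crowded_covered_ring : U_is_ring X.
Proof.
move=> f g uf ug; have [d d0 H] : exists2 d : R, 0 < d & forall x y : X,
    mdist x y < d -> `|f x - f y| < 1 /\ `|g x - g y| < 1.
  have /unif_continuous_mdistP/(_ 1 ltr01)[d d0 fd] := uf.
  have /unif_continuous_mdistP/(_ 1 ltr01)[d' d'0 gd] := ug.
  exists (Num.min d d') => [|x y]; first by rewrite lt_min d0.
  by rewrite lt_min => /andP[/fd ? /gd].
have [eta eta0 [_ /finite_seqP[s ->] sP]] := ccX d0.
have [M M0 MP] : exists2 M, 0 < M & forall x, crowded X eta x ->
    `|f x| <= M /\ `|g x| <= M.
  exists (1 + \sum_(z <- s) (`|f z| + `|g z|)) => [|x].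
    by rewrite ltr_pwDl // sumr_ge0 // => z _; rewrite addr_ge0.
  move=> /sP[z /= zs /H[fz gz]].
  have : `|f z| + `|g z| <= \sum_(z <- s) (`|f z| + `|g z|).
    rewrite (big_rem z) //= lerDl sumr_ge0 // => w _; exact: addr_ge0.
  have := (lerB_dist (f x) (f z), lerB_dist (g x) (g z)).
  have := (normr_ge0 (f z), normr_ge0 (g z)).
  by move: (\sum_(_ <- _) _) => S [? ?] [? ?] ?; split; lra.
apply/unif_continuous_mdistP => e e0.
have e1 : 0 < e / (M + M) by rewrite divr_gt0 ?addr_gt0.
have /unif_continuous_mdistP/(_ _ e1)[d1 d10 fd1] := uf.
have /unif_continuous_mdistP/(_ _ e1)[d2 d20 gd2] := ug.
exists (Num.min eta (Num.min d1 d2)) => [|x y].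
  by rewrite !lt_min eta0 d10.
rewrite !lt_min => /and3P[xy /fd1 fxy /gd2 gxy] /=.
have [->|xDy] := eqVneq x y; first by rewrite subrr normr0.
have [_ gx] : `|f x| <= M /\ `|g x| <= M by apply: MP; exists y.
have [fy _] : `|f y| <= M /\ `|g y| <= M.
  by apply: MP; exists x; rewrite 1?eq_sym // metric_sym.
have -> : f x * g x - f y * g y = (f x - f y) * g x + f y * (g x - g y) by ring.
apply: le_lt_trans (ler_normD _ _) _; rewrite !normrM.
apply: (@le_lt_trans _ _ (`|f x - f y| * M + M * `|g x - g y|)).
  by apply: lerD; [apply: ler_wpM2l|apply: ler_wpM2r].
have -> : e = (e / (M + M)) * M + M * (e / (M + M)).
  by rewrite (mulrC M) -mulrDr divfK // gt_eqF ?addr_gt0.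
by apply: ltrD; rewrite ?ltr_pM2l ?ltr_pM2r.
Qed.

(** Otherwise the remainder contains an infinite separated sequence. A function with value [n] at
    its [n]-th term and 0 elsewhere is uniformly continuous, since it vanishes at crowded points,
    yet it is unbounded on [A]. *)
Lemma Bourbaki_bounded_isolated (A : set X) (eta e : R) : 0 < eta -> 0 < e ->
  Bourbaki_bounded A -> finitely_covered e (A `\` crowded X eta).
Proof.
move=> eta0 e0 BA; apply: contrapT => NA.
have [z zA zsep] := separated_seq (fun _ : nat => NA).
have z_inj : injective z.
  move=> m n zmn; apply/eqP/negPn/negP => /zsep.
  by rewrite zmn mdistxx leNgt e0.
(* The default index 0 makes [f] vanish off the sequence. *)
pose f p : R := (xget 0%N [set n | z n = p])%:R.
have fz n : f (z n) = n%:R 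
  by rewrite /f; have /z_inj -> := @xgetI _ 0%N [set m | z m = z n] n erefl.
have f0 p : crowded X eta p -> f p = 0.
  move=> cp; rewrite /f; case: xgetP => // n _ zn.
  by have [_] := zA n; rewrite zn.
have uf : unif_continuous f.
  apply/unif_continuous_mdistP => c c0; exists eta => // p q pq.
  have [->|pDq] := eqVneq p q; first by rewrite subrr normr0.
  rewrite !f0 ?subrr ?normr0 //; last by exists q.
  by exists p; rewrite 1?eq_sym // metric_sym.
have [M [_ MP]] := BA f uf.
have M1 : M < `|M| + 1 by rewrite ltr_pwDr // ler_norm.
have /archi_boundP : 0 <= `|M| + 1 by rewrite addr_ge0.
set n := Num.bound _; have := MP _ M1 (z n) (proj1 (zA n)).
by rewrite /= fz normr_nat => /le_lt_trans H /H; rewrite ltxx.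
Qed.

Lemma crowded_covered_totally_bounded (A : set X) :
  Bourbaki_bounded A -> totally_bounded A.
Proof.
move=> BA e e0; have [eta eta0 [F finF FP]] := ccX e0.
have [F' finF' FP'] := Bourbaki_bounded_isolated eta0 e0 BA.
exists (F `|` F'); first by rewrite finite_setU.
move=> x Ax; have [/FP[z Fz xz]|xN] := pselect (crowded X eta x).
  by exists z => //; left.
by have [z Fz xz] := FP' x (conj Ax xN); exists z => //; right.
Qed.

Lemma crowded_covered_UC : complete_space X -> UC_space X.
Proof.
move=> cX f /continuous_mdistP cf; apply/unif_continuous_mdistP => e e0.
apply: contrapT => H.
pose S (d : R) := [set x | exists2 y, mdist x y < d & e <= `|f x - f y|].
have S_neq0 d : 0 < d -> S d !=set0.
  move=> d0; apply: contrapT => S0; apply: H; exists d => // x y xy.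
  by rewrite ltNge; apply/negP => fxy; apply: S0; exists x, y.
have S_crowded d : S d `<=` crowded X d.
  move=> x [y xy fxy]; exists y => //; apply/eqP => xEy; move: fxy.
  by rewrite xEy subrr normr0 leNgt e0.
have S_le d d' : d <= d' -> S d `<=` S d'.
  by move=> dd' x [y xy fxy]; exists y => //; apply: lt_le_trans dd'.
have [|G [UG SG]] :=
    @ultraFilterLemma X (filter_from [set d : R | 0 < d] S).
  apply: filter_from_proper => //; apply: filter_from_filter.
    by exists 1; exact: ltr01.
  move=> d d' /= d0 d'0; exists (Num.min d d'); rewrite /= ?lt_min ?d0 //.
  by move=> x Sx; split; apply: S_le Sx; rewrite ge_min lexx ?orbT.
have GS d : 0 < d -> G (S d) by move=> d0; apply: SG; exists d.
(* If no ball of radius [d] belonged to the ultrafilter [G], the complement of any finite union of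
   them would. But such a union covers some [S eta], which belongs to [G]. *)
have Gball d : 0 < d -> exists x, G (ball x d).
  move=> d0; have [eta eta0 [_ /finite_seqP[s ->] sP]] := ccX d0.
  apply: contrapT => NG.
  suff /filterI/(_ (GS _ eta0))/filter_ex[x [xs /S_crowded/sP[z zs xz]]] :
      G [set x | forall z, z \in s -> ~ ball z d x].
    by apply: xs zs _; rewrite ballEmdist /= metric_sym.
  elim: s {sP} => [|z s IH]; first exact: filterS filterT.
  have [Gz|/filterI/(_ IH)] := in_ultra_setVsetC (ball z d) UG.
    by case: NG; exists z.
  apply: filterS => x [xz xs] w; rewrite in_cons => /predU1P[->//|].
  exact: xs.
have [l Gl] := cX G _ (@cauchy_exP _ _ G _ Gball).
(* A point [x] of [S (d / 2)] within [d / 2] of [l] has its partner [y] within [d] of [l]; both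
   values of [f] are then within [e / 2] of [f l]. *)
have [d d0 fd] := cf l (e / 2) ltac:(by rewrite divr_gt0).
have d2 : 0 < d / 2 by rewrite divr_gt0.
have /metricType_numDomainType.fcvgrPdist_lt/(_ _ d2) Gd := Gl.
have [x [lx [y xy fxy]]] := filter_ex (filterI Gd (GS _ d2)).
have ly := metric_triangle l x y.
have /fd fx : mdist l x < d by apply: lt_trans lx _; lra.
have /fd fy : mdist l y < d by lra.
have := ler_distD (f l) (f x) (f y); rewrite (distrC (f x) (f l)).
by move=> ?; lra.
Qed.

End FromCoverings.

(** * The precompact set of condition (2) *)

Lemma crowded_coveredP {R : realType} {X : metricType R} :
  crowded_covered X <->
  exists2 L : set X, totally_bounded L &
    forall e : R, 0 < e -> uniformly_isolated (~` enlargement L e).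
Proof.
split=> [ccX|[L tbL LP] e e0]; last first.
  have e2 : 0 < e / 2 by rewrite divr_gt0.
  have [eta eta0 Leta] := LP _ e2; exists eta => //.
  have [F finF LF] := tbL _ e2; exists F => // x [y xDy xy].
  (* Outside this enlargement [x] would be isolated at scale [eta], contrary to the presence of
     [y]. *)
  have [z Lz xz] : enlargement L (e / 2) x.
    apply: contrapT => /Leta /seteqP[/(_ y xy) /= yx _].
    by rewrite yx eqxx in xDy.
  have [w Fw zw] := LF _ Lz; exists w => //.
  by apply: le_lt_trans (metric_triangle x z w) _; lra.
pose u n : R := n.+1%:R^-1.
have u0 n : 0 < u n by rewrite invr_gt0.
have /choice[eta etaP] n : exists t : R, 0 < t /\ finitely_covered (u n) (crowded X t).
  by have [t t0 tP] := ccX (u n) (u0 n); exists t.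
(* Intersecting over all [k <= n] makes [D] decreasing while it still contains a crowded set of
   positive scale. The nets [F n] are chosen inside [D n] so as to inherit this nesting. *)
pose D n := [set x | forall k, (k <= n)%N -> crowded X (eta k) x].
have /choice[F FP] n : exists F, [/\ finite_set F, F `<=` D n &
    D n `<=` enlargement F (u n + u n)].
  apply: finitely_covered_centered; have [_] := etaP n.
  by apply: finitely_covered_sub => x; apply.
have crowdedD n : exists2 t, 0 < t & crowded X t `<=` D n.
  elim: n => [|n [t t0 tD]].
    exists (eta 0%N) => [|x cx k]; first by have [] := etaP 0%N.
    by rewrite leqn0 => /eqP ->.
  exists (Num.min t (eta n.+1)).
    by rewrite lt_min t0; have [] := etaP n.+1.
  move=> x cx k; rewrite leq_eqVlt => /predU1P[->|].
    by apply: crowded_le cx; rewrite ge_min lexx orbT.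
  by rewrite ltnS; apply: tD; apply: crowded_le cx; rewrite ge_min lexx.
have u_small e : 0 < e -> exists n, u n + u n < e.
  move=> e0; have [|N /(_ N (leqnn N)) NP] := @invSn_small _ (e / 2).
    by rewrite divr_gt0.
  by exists N; rewrite [ltRHS]splitr ltrD.
(* F m lies in D n for all m >= n, whence the total boundedness of the union. *)
exists (\bigcup_n F n) => e e0; have [N Ne] := u_small e e0.
  exists (\bigcup_(n in `I_N.+1) F n).
    by apply: bigcup_finite => // n _; have [] := FP n.
  move=> x [n _ Fx]; have [nN|Nn] := ltnP n N.+1.
    by exists x; [exists n|rewrite mdistxx].
  have [_ FD _] := FP n; have [_ _ DF] := FP N.
  have /DF[z Fz xz] : D N x.
    by move=> k kN; apply: FD Fx _ _; apply: leq_trans kN (ltnW Nn).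
  by exists z; [exists N => //=|apply: lt_trans Ne].
have [t t0 tD] := crowdedD N; exists t => // x xN.
apply: isolated_notin_crowded => // /tD; have [_ _ DF] := FP N.
by move=> /DF[z Fz xz]; apply: xN; exists z; [exists N|apply: lt_trans Ne].
Qed.

(** * Passage to the completion and back *)

Lemma completion_crowded_covered {R : realType} {X Y : metricType R}
    (i : X -> Y) : is_completion i -> crowded_covered Y <-> crowded_covered X.
Proof.
move=> [_ mono_i dense_i].
have approx (p : Y) (d : R) : 0 < d -> exists x, mdist p (i x) < d.
  move=> d0; have [|q [pq [x _ xq]]] :=
      dense_i (ball p d)^° _ (open_interior (ball p d)).
    by exists p; apply: nbhsx_ballx.
  by exists x; rewrite xq; move: pq => /interior_subset; rewrite ballEmdist.
split=> cc e e0; have e2 : 0 < e / 2 by rewrite divr_gt0.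
  have [eta eta0 [F finF FP]] := cc _ e2; exists eta => //.
  have /choice[c cP] p := approx p _ e2.
  exists (c @` F) => [|x [y xDy xy]]; first exact: finite_image.
  have [p Fp xp] : enlargement F (e / 2) (i x).
    by apply: FP; exists (i y); rewrite ?mono_i // -mdist_gt0 mono_i mdist_gt0.
  exists (c p); first by exists p.
  rewrite -mono_i; apply: le_lt_trans (metric_triangle _ p _) _.
  by have := cP p => ?; lra.
have [eta eta0 [F finF FP]] := cc _ e2; exists eta => //.
exists (i @` F) => [|p [q pDq pq]]; first exact: finite_image.
have pq0 : 0 < mdist p q by rewrite mdist_gt0.
(* The first bound serves the final triangle inequality, the second keeps the approximants [x] and
   [y] distinct, and the third keeps them closer than [eta]. *)
pose d := Num.min (e / 2) (Num.min (mdist p q / 2) ((eta - mdist p q) / 2)).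
have d0 : 0 < d by rewrite !lt_min e2 !divr_gt0 // subr_gt0.
have [x] := approx p d d0; have [y] := approx q d d0.
rewrite !lt_min => /and3P[_ qy1 qy2] /and3P[px px1 px2].
have xp := metric_sym (i x) p; have yq := metric_sym (i y) q.
have t1 := metric_triangle p (i x) q; have t2 := metric_triangle (i x) (i y) q.
have t3 := metric_triangle (i x) p (i y); have t4 := metric_triangle p q (i y).
have [z Fz xz] : enlargement F (e / 2) x.
  apply: FP; exists y; last by rewrite -mono_i; lra.
  by rewrite -mdist_gt0 -mono_i; lra.
exists (i z); first by exists z.
apply: le_lt_trans (metric_triangle p (i x) (i z)) _.
by rewrite mono_i; lra.
Qed.

Theorem corollary3p6 (R : realType) (X : metricType R) :
  [<-> U_is_ring X /\ (forall A : set X, Bourbaki_bounded A -> totally_bounded A);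
       exists2 L : set X, totally_bounded L &
         forall e : R, 0 < e -> uniformly_isolated (~` enlargement L e);
       UC_space (completion X)].
Proof.
have cP := completion_crowded_covered (completionP X).
have [cY _ _] := completionP X.
tfae=> [[ringX BT]|/crowded_coveredP ccX|/UC_crowded_covered/cP ccX].
- exact/crowded_coveredP/ring_crowded_covered.
- by apply: crowded_covered_UC cY; exact/cP.
- by split; [exact: crowded_covered_ring|exact: crowded_covered_totally_bounded].
Qed.
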